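(* Let $k \geq 2$, let $T_k$ be the infinite $k$-regular tree, and let $G_k$ be its automorphism group, acting on the vertices of $T_k$. Then the action $G_k \curvearrowright T_k$ is nilrigid. That is, for every finite set $A$, every cellular automaton $f : A^{T_k} \to A^{T_k}$ on $(G_k, T_k)$ that is asymptotically nilpotent is uniformly asymptotically nilpotent.
   Context: $T_k$ denotes the infinite (rootless, leafless) undirected tree in which every vertex has degree $k$. $G_k$ is the group of all bijections of the vertex set that preserve edges, regarded as a discrete group. By abuse of notation $T_k$ also denotes the vertex set, so $A^{T_k}$ is the set of all functions from the vertices of $T_k$ to $A$. Cellular automaton: let $T$ be a set and $G \curvearrowright T$ a group action. For a finite set $A$ (the alphabet), give $A^T$ the product topology ($A$ discrete) and let $G$ act on $A^T$ by $(gx)_h = x_{g^{-1}h}$ for $g \in G$, $x \in A^T$, $h \in T$. A cellular automaton on $(G,T)$ is a continuous function $f : A^T \to A^T$ such that $f(gx) = g f(x)$ for all $g \in G$ and $x \in A^T$. Nilpotency: a function $f : X \to X$ on a topological space $X$ is asymptotically nilpotent (towards a point $0 \in X$) if $f^n(x) \to 0$ as $n \to \infty$ for all $x \in X$. It is uniformly asymptotically nilpotent (towards $0$) if moreover the convergence is uniform over $X$. For $X = A^T$ this means that for every neighborhood $U$ of $0$ there is $N \in \mathbb{N}$ such that $f^n(x) \in U$ for all $n \geq N$ and all $x \in X$. Nilrigidity: a group action $G \curvearrowright T$ is nilrigid if for every finite alphabet $A$, every asymptotically nilpotent cellular automaton $f : A^T \to A^T$ on $(G,T)$ is uniformly asymptotically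 nilpotent. *)

(* Defs.v *)
From HB Require Import structures.
From mathcomp Require Import all_boot all_order all_algebra.
From mathcomp Require Import all_classical all_reals topology.

Set Implicit Arguments.
Unset Strict Implicit.
Unset Printing Implicit Defensive.

Local Open Scope classical_set_scope.

Record group_action (G : groupType) (T : Type) := GroupAction {
  act :> G -> T -> T;
  act1 : forall t, act 1%g t = t;
  actM : forall g h t, act (g * h)%g t = act g (act h t) }.

(* [A^T] with the product topology, [A] being discrete. *)
Notation config T A := {ptws T -> discrete_topology A}.

Definition config_act (G : groupType) (T : Type) (a : group_action G T)
    (A : finType) (g : G) (x : config T A) : config T A :=
  fun h => x (a g^-1%g h).

Definition cellular_automaton (G : groupType) (T : Type)
    (a : group_action G T) (A : finType) (f : config T A -> config T A) : Prop :=
  continuous f /\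
  forall (g : G) (x : config T A), f (config_act a g x) = config_act a g (f x).

Definition asymptotically_nilpotent (X : topologicalType) (f : X -> X) (z : X)
    : Prop :=
  forall x : X, iter n f x @[n --> \oo] --> z.

Definition uniformly_asymptotically_nilpotent (X : topologicalType)
    (f : X -> X) (z : X) : Prop :=
  asymptotically_nilpotent f z /\
  forall U : set X, nbhs z U ->
    exists N : nat, forall (n : nat) (x : X), (N <= n)%N -> U (iter n f x).

(* The limit point [z] is an arbitrary configuration, not a distinguished
   (e.g. uniform) one. *)
Definition nilrigid (G : groupType) (T : Type) (a : group_action G T) : Prop :=
  forall (A : finType) (f : config T A -> config T A), cellular_automaton a f ->
  forall z : config T A,
    asymptotically_nilpotent f z -> uniformly_asymptotically_nilpotent f z.

(* [e] is the adjacency relation of a nonempty simple undirected graph.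
   A [ucycle] of size 2 is an edge traversed back and forth, hence the bound
   in the acyclicity clause. *)
Record regular_tree (k : nat) (V : choiceType) (e : rel V) : Prop := RegularTree {
  tree_inhabited : inhabited V;
  tree_sym : symmetric e;
  tree_irr : irreflexive e;
  tree_connected : forall x y, exists2 p, path e x p & last x p = y;
  tree_acyclic : forall c, ucycle e c -> size c <= 2;
  tree_degree : forall x, exists s : seq V,
    [/\ uniq s, size s = k & forall y, (y \in s) = e x y] }.

Section GraphAut.
Context (V : choiceType) (e : rel V).

(* The inverse bijection is part of the data; it is determined by [aut_fun],
   see [graph_aut_eq]. *)
Record graph_aut := GraphAut {
  aut_fun :> V -> V;
  aut_inv : V -> V;
  aut_funK : cancel aut_fun aut_inv;
  aut_invK : cancel aut_inv aut_fun;
  aut_edge : forall x y, e (aut_fun x) (aut_fun y) = e x y }.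

Lemma graph_aut_eq (g h : graph_aut) : g =1 h -> g = h.
Proof.
case: g h => [f f' fK f'K fe] [l l' lK l'K le] /= /funext fl; subst l.
have fl' : f' = l' by apply/funext => x; rewrite -[LHS]lK f'K.
by subst l'; f_equal; apply: Prop_irrelevance.
Qed.

HB.instance Definition _ := gen_eqMixin graph_aut.
HB.instance Definition _ := gen_choiceMixin graph_aut.

Definition aut_one : graph_aut :=
  @GraphAut id id (fun=> erefl) (fun=> erefl) (fun _ _ => erefl).

Lemma aut_inv_edge (g : graph_aut) x y : e (aut_inv g x) (aut_inv g y) = e x y.
Proof. by rewrite -(aut_edge g) !aut_invK. Qed.

Definition aut_inverse (g : graph_aut) : graph_aut :=
  GraphAut (aut_invK g) (aut_funK g) (aut_inv_edge g).

Lemma aut_mul_edge (g h : graph_aut) x y : e (g (h x)) (g (h y)) = e x y.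
Proof. by rewrite !aut_edge. Qed.

Definition aut_mul (g h : graph_aut) : graph_aut :=
  @GraphAut (g \o h) (aut_inv h \o aut_inv g)
    (can_comp (aut_funK g) (aut_funK h)) (can_comp (aut_invK h) (aut_invK g))
    (aut_mul_edge g h).

Let aut_mulA : associative aut_mul.
Proof. by move=> f g h; exact: graph_aut_eq. Qed.
Let aut_mul1g : left_id aut_one aut_mul.
Proof. by move=> g; exact: graph_aut_eq. Qed.
Let aut_mulg1 : right_id aut_one aut_mul.
Proof. by move=> g; exact: graph_aut_eq. Qed.
Let aut_mulVg : left_inverse aut_one aut_inverse aut_mul.
Proof. by move=> g; apply: graph_aut_eq => x /=; rewrite aut_funK. Qed.
Let aut_mulgV : right_inverse aut_one aut_inverse aut_mul.
Proof. by move=> g; apply: graph_aut_eq => x /=; rewrite aut_invK. Qed.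

HB.instance Definition _ := isGroup.Build graph_aut
  aut_mulA aut_mul1g aut_mulg1 aut_mulVg aut_mulgV.

Definition aut_action : group_action graph_aut V :=
  @GroupAction graph_aut V aut_fun (fun=> erefl) (fun _ _ _ => erefl).

End GraphAut.

(* Main.v *)
From HB Require Import structures.
Require Import Defs.
From mathcomp Require Import all_boot all_order all_algebra zify.
From mathcomp Require Import boolp classical_sets topology.
Import Order.TTheory GRing.Theory Num.Theory.

Set Implicit Arguments.
Unset Strict Implicit.
Unset Printing Implicit Defensive.

(** Since [f] commutes with a transitive group, the limit configuration is
    constant; call its symbol [a0] quiescent. By continuity, compactness and
    transitivity, [f x v] only depends on [x] on the ball of some fixed radius
    [r] around [v]. A configuration is mortal if some iterate of it is quiescent
    everywhere.

    Two facts hold for every pointwise nilpotent local map on a locally finite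
    metric space. If some quiescent ball protects its centre forever, then, by
    compactness, the centre is quiescent from a uniform time on
    ([zero_ball_wall_uniform]). And finite mortal configurations cannot reach a
    given cell from arbitrarily far away ([mortal_zero_ball]): otherwise put
    infinitely many of them around that cell, each one so far out that the
    previous ones are dead before it interacts with them; the cell is then
    hit infinitely often. Together they reduce the theorem to showing that every
    finite configuration is mortal.

    In dimension one ([one_dimensional_nilpotent]), the Baire category argument
    of [exists_wall] gives a wall: a finite pattern [w] that forces the cells
    around its centre to be quiescent from some time [N] on, whatever surrounds
    it. Suppose that no quiescent interval protects its centre. Then [w] on its
    own is not mortal, because once it had died something from far away could
    hit its centre. As each cell is eventually quiescent, [w] must reach cells
    [v] arbitrarily far away at late times. Add copies of [w] at two very distant
    positions [L] and [- L], run the map for [N] steps and erase everything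
    outside the interval between them. What remains can never leave this
    interval, so it is mortal; it starts far from [v], and it hits [v] before [v]
    can feel the outer walls. This contradicts [mortal_zero_ball], so that
    [zero_ball_wall_uniform] applies.

    On a tree of degree at least 3, pairwise distant walls cannot enclose a
    finite region, and the argument does not carry over. But the automorphisms
    fixing an end act transitively on each level (horosphere) of the end, so the
    configurations that are constant on levels evolve as a one-dimensional
    cellular automaton and die within a uniform time [N]
    ([horocyclic_nilpotent]). Now let [x] be a finite configuration supported in
    a ball, and [u] a vertex outside. The automorphisms that fix everything not
    separated from the ball by [u] preserve [x], hence all its iterates, which
    are therefore constant on levels below [u]. Deep below [u] they look like a
    configuration constant on all levels, so after [N] steps they are quiescent
    there ([descendants_die]). Thus the orbit of [x] stays in a larger ball,
    and [x] is mortal ([finite_mortal]). *)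

(** * Locally finite metrics and local maps *)

Record locally_finite_metric (V : choiceType) (dist : V -> V -> nat) : Prop :=
  LocallyFiniteMetric {
    dist_refl : forall v, dist v v = 0;
    dist_sym : forall u v, dist u v = dist v u;
    dist_triangle : forall u v w, dist u w <= dist u v + dist v w;
    dist_ball_finite :
      forall v n, exists s : seq V, forall u, dist v u <= n -> u \in s }.

Section LocalMaps.
Context (V : choiceType) (A : finType) (dist : V -> V -> nat).

Definition agree n v (x y : V -> A) := forall u, dist v u <= n -> x u = y u.

Definition local r (f : (V -> A) -> V -> A) :=
  forall v x y, agree r v x y -> f x v = f y v.

Definition pointwise_nilpotent (a0 : A) (f : (V -> A) -> V -> A) :=
  forall x v, exists N, forall n, N <= n -> iter n f x v = a0.

Definition mortal (a0 : A) (f : (V -> A) -> V -> A) x :=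
  exists n, iter n f x = fun=> a0.

Hypothesis metric : locally_finite_metric dist.

Lemma agree_sym n v x y : agree n v x y -> agree n v y x.
Proof. by move=> xy u vu; rewrite xy. Qed.

Lemma agree_trans n v x y z : agree n v x y -> agree n v y z -> agree n v x z.
Proof. by move=> xy yz u vu; rewrite xy // yz. Qed.

Lemma agree_le n m v x y : m <= n -> agree n v x y -> agree m v x y.
Proof. by move=> mn xy u vu; apply: xy; apply: leq_trans mn. Qed.

Lemma agree_at n v x y : agree n v x y -> x v = y v.
Proof. by apply; rewrite (dist_refl metric). Qed.

Lemma agree_move n m v w x y : dist v w + m <= n -> agree n v x y -> agree m w x y.
Proof.
move=> vwm xy u wu; apply: xy; apply: leq_trans vwm.
by apply: leq_trans (dist_triangle metric v w u) _; rewrite leq_add2l.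
Qed.

Lemma iter_local r f n m v x y :
  local r f -> agree (r * n + m) v x y -> agree m v (iter n f x) (iter n f y).
Proof.
move=> fr; elim: n m => [|n IHn] m xy; first by rewrite muln0 in xy.
move=> u vu /=; apply: fr; apply: (@agree_move (r + m) r v); first by lia.
by apply: IHn; apply: agree_le xy; lia.
Qed.

(** ** Limits of nested patterns *)

Lemma nested_limit o (X : nat -> V -> A) (R : nat -> nat) :
  (forall i, R i < R i.+1) -> (forall i, agree (R i) o (X i) (X i.+1)) ->
  exists x, forall i, agree (R i) o (X i) x.
Proof.
move=> Rlt Xagree.
have Rge i : i <= R i by elim: i => // i IHi; apply: leq_ltn_trans (Rlt i).
have Rle i j : R i <= R (i + j).
  by elim: j => [|j IHj]; rewrite ?addn0 // addnS (leq_trans IHj) // ltnW.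
have step i j : agree (R i) o (X i) (X (i + j)).
  elim: j => [|j IHj]; rewrite ?addn0 // addnS.
  by apply: agree_trans IHj _; apply: agree_le (Xagree _).
exists (fun u => X (dist o u) u) => i u ou.
have [le_i|/ltnW le_i] := leqP i (dist o u).
  by rewrite -(subnKC le_i); apply: step.
by rewrite -(subnKC le_i); apply/esym/step.
Qed.

Lemma dependent_choice_at (T : Type) (P : T -> Prop) (E : nat -> T -> T -> Prop) t0 :
  P t0 -> (forall n t, P t -> exists2 t', P t' & E n t t') ->
  exists F, forall n, P (F n) /\ E n (F n) (F n.+1).
Proof.
move=> Pt0 next.
have /choice[h hP] : forall nt : nat * T, exists t',
    P nt.2 -> P t' /\ E nt.1 nt.2 t'.
  move=> [n t]; have [Pt|nPt] := pselect (P t); last by exists t.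
  by have [t' Pt' Et'] := next n t Pt; exists t'.
pose F := fix F n := if n is m.+1 then h (m, F m) else t0.
have PF n : P (F n) by elim: n => //= n IHn; have [] := hP (n, F n) IHn.
by exists F => n; split=> //; have [] := hP (n, F n) (PF n).
Qed.

(** Compactness of the space of configurations, for a property that holds
    locally uniformly. The proof is Koenig's lemma: a pattern is bad if no [N]
    serves all its extensions, and a bad pattern has a bad extension to one more
    cell because the alphabet is finite. *)
Lemma config_compact (a0 : A) o (Q : (V -> A) -> nat -> Prop) :
  (forall x N M, N <= M -> Q x N -> Q x M) ->
  (forall x, exists R N, forall x', agree R o x x' -> Q x' N) ->
  exists N, forall x, Q x N.
Proof.
move=> Qmono Qopen; apply: contrapT => noN.
pose bad (S : V -> Prop) x :=
  forall N, exists2 x' : V -> A, (forall u, S u -> x u = x' u) & ~ Q x' N.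
have bad_add S x v : bad S x ->
    exists2 y, (forall u, S u -> x u = y u) & bad (fun u => S u \/ u = v) y.
  move=> Sx.
  have [a aP] : exists a, forall N,
      exists x', [/\ forall u, S u -> x u = x' u, x' v = a & ~ Q x' N].
    apply: contrapT => /forallNP noa.
    have /choice[M MP] : forall a, exists N, forall x',
        (forall u, S u -> x u = x' u) -> x' v = a -> Q x' N.
      move=> a; have /existsNP[N NP] := noa a; exists N => x' xx' x'v.
      by apply: contrapT => nQ; apply: NP; exists x'.
    have [x' xx' []] := Sx (\max_a M a).
    by apply: Qmono (MP _ _ xx' erefl); apply: leq_bigmax.
  exists (fun u => if u == v then a else x u).
    move=> u Su; case: eqP => // uv.
    by have [x' [xx' x'v _]] := aP 0; rewrite uv -x'v xx' // -uv.
  move=> N; have [x' [xx' x'v nQ]] := aP N; exists x' => // u.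
  by case: eqP => [-> _|uv [Su|//]]; [rewrite x'v|apply: xx'].
have bad_cat S x (t : seq V) : bad S x ->
    exists2 y, (forall u, S u -> x u = y u) & bad (fun u => S u \/ u \in t) y.
  elim: t => [|v t IHt] Sx.
    exists x => // N; have [x' xx' nQ] := Sx N; exists x' => // u /= [/xx'//|//].
  have [y xy ybad] := IHt Sx; have [z yz zbad] := bad_add _ _ v ybad.
  exists z => [u Su|N]; first by rewrite xy // yz //; left.
  have [x' zx' nQ] := zbad N; exists x' => // u.
  rewrite /= inE => -[Su|/orP[/eqP->|ut]]; apply: zx'; last 2 first.
  - by right.
  - by left; right.
  by left; left.
have bad_ball S x R : bad S x ->
    exists2 y, (forall u, S u -> x u = y u) & bad (fun u => dist o u <= R) y.
  have [t tP] := dist_ball_finite metric o R.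
  move=> Sx; have [y xy ybad] := bad_cat _ _ t Sx; exists y => // N.
  by have [x' yx' nQ] := ybad N; exists x' => // u ou; apply: yx'; right; apply: tP.
have [x0 _ x0bad] : exists2 y, (forall u, False -> a0 = y u)
    & bad (fun u => dist o u <= 0) y.
  apply: (@bad_ball (fun=> False) (fun=> a0)) => N.
  have /forallNP/(_ N) nN := noN.
  by have /existsNP[x' nQ] := nN; exists x'.
pose P (t : nat * (V -> A)) := bad (fun u => dist o u <= t.1) t.2.
pose E (n : nat) (t t' : nat * (V -> A)) := t'.1 = t.1.+1 /\ agree t.1 o t.2 t'.2.
have [//|n [R x] /= xbad|F FP] := @dependent_choice_at _ P E (0, x0).
  by have [y xy ybad] := bad_ball _ _ R.+1 xbad; exists (R.+1, y).
have [||x xP] := @nested_limit o (fun i => (F i).2) (fun i => (F i).1).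
- by move=> i; have [_ [->]] := FP i.
- by move=> i; have [_ [_]] := FP i.
have [R [N RN]] := Qopen x.
have leR : R <= (F R).1.
  by elim: (R) => // i IHi; have [_ [-> _]] := FP i.
have [x' xx' []] := (FP R).1 N; apply: RN.
apply: agree_trans (agree_sym (agree_le leR (xP R))) _.
exact: agree_le xx'.
Qed.

(** ** Consequences of pointwise nilpotency *)

Section Nilpotent.
Context (a0 : A) (r : nat) (f : (V -> A) -> V -> A).
Hypothesis flocal : local r f.
Hypothesis f0 : f (fun=> a0) = fun=> a0.
Hypothesis fnil : pointwise_nilpotent a0 f.
Local Notation zero := (fun=> a0).

Lemma iter0 n : iter n f zero = zero.
Proof. by elim: n => //= n ->. Qed.

Lemma iter_zero n m v x :
  agree (r * n + m) v x zero -> agree m v (iter n f x) zero.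
Proof. by move=> /(iter_local flocal); rewrite iter0. Qed.

Lemma nilpotent_ball x v m :
  exists N, forall n, N <= n -> agree m v (iter n f x) zero.
Proof.
have [s sP] := dist_ball_finite metric v m.
have /choice[N NP] := fnil x.
exists (\max_(u <- s) N u) => n Nn u vu; apply: NP; apply: leq_trans Nn.
by apply: leq_bigmax_seq => //; apply: sP.
Qed.

(** An orbit confined to a finite set of cells dies as soon as all of these cells
    are quiescent for good. *)
Lemma mortal_bounded x o R :
  (forall n u, R < dist o u -> iter n f x u = a0) -> mortal a0 f x.
Proof.
move=> xR; have [N /(_ N (leqnn N)) NP] := nilpotent_ball x o R.
exists N; apply/funext => u.
by have [/NP//|/xR->] := leqP (dist o u) R.
Qed.

(** The engine of [exists_wall] and [mortal_zero_ball]. A pair [x], [R] stands for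
    the pattern of [x] on the ball of radius [R]. If all patterns admissible for
    [S] can be extended so as to hit the ball of radius [m] around [o] at a later
    time, the limit of successive extensions hits it infinitely often. *)
Lemma recurrent_hits (S : (V -> A) -> nat -> Prop) o m x0 R0 :
  S x0 R0 ->
  (forall x R n0, S x R -> exists x' R',
     [/\ S x' R', R < R', agree R o x x'
       & exists n, [/\ n0 <= n, r * n + m <= R'
                      & ~ agree m o (iter n f x') zero]]) ->
  False.
Proof.
move=> Sx0 next.
pose P (t : nat * (V -> A)) := S t.2 t.1.
pose E (n0 : nat) (t t' : nat * (V -> A)) := [/\ t.1 < t'.1, agree t.1 o t.2 t'.2
  & exists n, [/\ n0 <= n, r * n + m <= t'.1
                & ~ agree m o (iter n f t'.2) zero]].
have [//||F FP] := @dependent_choice_at _ P E (R0, x0).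
  move=> n [R x] /= Sx; have [x' [R' [Sx' RR' xx' hit]]] := next _ _ n Sx.
  by exists (R', x').
have [||x xP] := @nested_limit o (fun i => (F i).2) (fun i => (F i).1).
- by move=> i; have [_ []] := FP i.
- by move=> i; have [_ []] := FP i.
have [N NP] := nilpotent_ball x o m.
have [_ [_ _ [n [Nn nR []]]]] := FP N.
apply: agree_trans (NP _ Nn); apply: (iter_local flocal).
by apply: agree_le nR _; apply: xP.
Qed.

(** If no pattern were a wall, each one would have an extension with a late hit. *)
Lemma exists_wall o m : exists w R N, forall x, agree R o w x ->
  forall n, N <= n -> agree m o (iter n f x) zero.
Proof.
apply: contrapT => nowall.
apply: (@recurrent_hits (fun _ _ => True) o m zero 0) => // x R n0 _.
have [x' [xx' [n [n0n hit]]]] : exists x', agree R o x x' /\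
    exists n, n0 <= n /\ ~ agree m o (iter n f x') zero.
  apply: contrapT => nox'; apply: nowall; exists x, R, n0 => x' xx' n n0n.
  by apply: contrapT => hit; apply: nox'; exists x'; split=> //; exists n.
exists x', (R + (r * n + m)).+1; split=> //; first by lia.
by exists n; split=> //; lia.
Qed.

(** The orbit of [x] makes the ball of radius [D] quiescent at some time, which
    by compactness is bounded independently of [x]; from then on [o] is
    protected. *)
Lemma zero_ball_wall_uniform o D :
  (forall x, agree D o x zero -> forall n, iter n f x o = a0) ->
  exists N, forall x n, N <= n -> iter n f x o = a0.
Proof.
move=> Dwall.
have [N NP] : exists N, forall x, exists2 n, n <= N & agree D o (iter n f x) zero.
  apply: (config_compact a0 (o := o)) => [x N M NM [n nN nP]|x].
    by exists n => //; apply: leq_trans NM.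
  have [N NP] := nilpotent_ball x o D; exists (r * N + D), N => x' xx'.
  exists N => //; apply: agree_trans (NP N (leqnn N)).
  by apply: (iter_local flocal); apply: agree_sym.
exists N => x n Nn; have [i iN /Dwall/(_ (n - i))] := NP x.
by rewrite -iterD subnK //; apply: leq_trans iN Nn.
Qed.

(** Until time [T] the two configurations are too far apart to interact, and then
    [w] is dead. *)
Lemma superpose w q o R D T (x := fun u => if dist o u <= R then w u else q u) :
  (forall u, R < dist o u -> w u = a0) -> iter T f w = zero ->
  agree D o q zero -> R + 2 * (r * T) <= D -> iter T f x = iter T f q.
Proof.
move=> wR wT q0 RD; apply/funext => v.
have [vle|vgt] := leqP (dist o v) (R + r * T).
  transitivity a0; last first.
    by apply/esym/(agree_at (n := 0))/iter_zero; apply: agree_move q0; lia.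
  rewrite -[RHS](congr1 (@^~ v) wT).
  apply: (agree_at (n := 0)); apply: (iter_local flocal) => u vu.
  rewrite /x; case: leqP => // uR; rewrite wR // q0 //.
  by have := dist_triangle metric o v u; lia.
apply: (agree_at (n := 0)); apply: (iter_local flocal) => u vu.
rewrite /x ifF //; apply/negbTE; rewrite -ltnNge.
by have := dist_triangle metric o u v; rewrite (dist_sym metric u v); lia.
Qed.

(** Otherwise [recurrent_hits] applies to the finite mortal configurations: to
    one that dies at time [T], add a mortal one so distant that it neither
    meets the first by time [T] nor hits [o] by time [n0 + T]. *)
Lemma mortal_zero_ball o : exists D, forall q R,
  (forall u, R < dist o u -> q u = a0) -> mortal a0 f q ->
  agree D o q zero -> forall n, iter n f q o = a0.
Proof.
apply: contrapT => noD.
have {noD} getq D : exists q R n, [/\ forall u, R < dist o u -> q u = a0,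
    mortal a0 f q, agree D o q zero & iter n f q o <> a0].
  apply: contrapT => noq; apply: noD; exists D => q R qR qmort qD n.
  by apply: contrapT => hit; apply: noq; exists q, R, n.
pose S x R := (forall u, R < dist o u -> x u = a0) /\ mortal a0 f x.
apply: (@recurrent_hits S o 0 zero 0).
  by split=> //; exists 0.
move=> x R n0 [xR [T xT]].
pose D := R + 2 * (r * T) + r * (n0 + T).
have [q [R' [n [qR' [T' qT'] qD hit]]]] := getq D.
have n_large : n0 + T < n.
  rewrite ltnNge; apply/negP => n_small; apply: hit.
  apply: (agree_at (n := 0)); apply: iter_zero; apply: agree_le qD.
  by have := leq_mul (leqnn r) n_small; rewrite /D; lia.
pose x' := fun u => if dist o u <= R then x u else q u.
have x'T : iter T f x' = iter T f q.
  by apply: superpose xR xT qD _; rewrite /D; lia.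
have x'late m : T <= m -> iter m f x' = iter m f q.
  by move=> Tm; rewrite -(subnK Tm) !iterD x'T.
exists x', (R + R' + (r * n)).+1; split=> //; first split.
- by move=> u ou; rewrite /x' ifF ?qR' //; [lia|apply/negbTE; lia].
- by exists (T + T'); rewrite x'late ?leq_addr // iterD qT' iter0.
- by lia.
- by move=> u ou; rewrite /x' ou.
exists n; split; [lia|lia|].
by move=> /agree_at; rewrite x'late //; lia.
Qed.

End Nilpotent.
End LocalMaps.

(** * One-dimensional cellular automata *)

Definition int_dist (i j : int) : nat := absz (i - j)%R.

Lemma int_metric : locally_finite_metric int_dist.
Proof.
split=> [v|u v|u v w|v n]; rewrite /int_dist; try lia.
exists [seq (v - Posz n + Posz j)%R | j <- iota 0 (2 * n).+1] => u uv.
apply/mapP; exists (absz (u - v + Posz n)%R); last by lia.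
by rewrite mem_iota; lia.
Qed.

Section OneDimensional.
Context (A : finType) (a0 : A) (r : nat) (f : (int -> A) -> int -> A).
Hypothesis flocal : local int_dist r f.
Hypothesis fshift : forall c y, f (fun i => y (i + c)%R) = fun i => f y (i + c)%R.
Hypothesis f0 : f (fun=> a0) = fun=> a0.
Hypothesis fnil : pointwise_nilpotent a0 f.
Local Notation zero := (fun=> a0).
Local Notation dist := int_dist.

Lemma iter_shift n c y :
  iter n f (fun i => y (i + c)%R) = fun i => iter n f y (i + c)%R.
Proof. by elim: n => //= n ->; rewrite fshift. Qed.

Definition truncate L (x : int -> A) i := if dist 0%R i <= L then x i else a0.

(** Quiescent windows of radius [r] at [L] and [- L] let no information through,
    so that erasing the outside commutes with the map. *)
Lemma truncate_zero_windows L x :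
  agree dist r (Posz L) x zero -> agree dist r (- Posz L)%R x zero ->
  f (truncate L x) = truncate L (f x).
Proof.
move=> xL xNL; apply/funext => i; rewrite /truncate.
case: leqP => iL.
  apply: flocal => j ij; rewrite /truncate; case: leqP => // jL.
  rewrite /int_dist in iL ij jL.
  by have [/ltW jpos|jneg] := ltP 0%R j; [rewrite xL|rewrite xNL] => //;
    rewrite /int_dist; lia.
rewrite -[RHS](congr1 (@^~ i) f0); apply: flocal => j ij.
rewrite /truncate; case: leqP => // jL.
rewrite /int_dist in iL ij jL.
by have [/ltW jpos|jneg] := ltP 0%R j; [rewrite xL|rewrite xNL] => //;
  rewrite /int_dist; lia.
Qed.

Lemma iter_truncate_between_walls N L x :
  (forall m, N <= m -> agree dist r (Posz L) (iter m f x) zero) ->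
  (forall m, N <= m -> agree dist r (- Posz L)%R (iter m f x) zero) ->
  forall n, iter n f (truncate L (iter N f x)) = truncate L (iter (n + N) f x).
Proof.
move=> wallR wallL; elim=> // n IHn.
rewrite iterS IHn truncate_zero_windows ?addSn //.
  by apply: wallR; lia.
by apply: wallL; lia.
Qed.

(** If [w] died at time [T], a distant configuration [q] could be added to it
    whose first hit of the centre comes after [N] and [T]. *)
Lemma wall_immortal w R N :
  (forall u, R < dist 0%R u -> w u = a0) ->
  (forall x, agree dist R 0%R w x ->
     forall n, N <= n -> iter n f x 0%R = a0) ->
  (forall D, exists q n, agree dist D 0%R q zero /\ iter n f q 0%R <> a0) ->
  ~ mortal a0 f w.
Proof.
move=> wR wall getq [T wT].
have [q [n [qD hit]]] := getq (R + 2 * (r * T) + r * (N + T)).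
have n_large : N + T < n.
  rewrite ltnNge; apply/negP => n_small; apply: hit.
  apply: (agree_at int_metric (n := 0)); apply: (iter_zero int_metric flocal f0).
  by apply: agree_le qD; have := leq_mul (leqnn r) n_small; lia.
apply: hit; rewrite -[RHS](wall (fun u => if dist 0%R u <= R then w u else q u) _ n).
- have Tn : T <= n by lia.
  rewrite -(subnK Tn) !iterD.
  by rewrite (superpose int_metric flocal f0 wR wT qD) //; lia.
- by move=> u ->.
- by lia.
Qed.

Lemma one_dimensional_nilpotent : exists N, forall y n, N <= n -> iter n f y = zero.
Proof.
apply: contrapT => notnil.
have getq D : exists q n, agree dist D 0%R q zero /\ iter n f q 0%R <> a0.
  apply: contrapT => noq; apply: notnil.
  have [|N NP] := zero_ball_wall_uniform int_metric flocal fnil (o := 0%R) (D := D).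
    move=> x xD n; apply: contrapT => hit.
    by apply: noq; exists x, n.
  exists N => y n Nn; apply/funext => i.
  by have := NP (fun j => y (j + i)%R) n Nn; rewrite iter_shift add0r.
have [w0 [R [N w0P]]] := exists_wall int_metric flocal fnil 0%R r.
pose w := truncate R w0.
have wR u : R < dist 0%R u -> w u = a0.
  by rewrite /w /truncate ltnNge => /negbTE->.
have wall x : agree dist R 0%R w x -> forall n, N <= n ->
    agree dist r 0%R (iter n f x) zero.
  move=> wx; apply: w0P => u uR; rewrite -wx //.
  by rewrite /w /truncate uR.
have wimm : ~ mortal a0 f w.
  apply: (wall_immortal (R := R) (N := N) wR _ getq) => x wx n Nn.
  exact: (agree_at int_metric (wall _ wx _ Nn)).
have [D DP] := mortal_zero_ball int_metric flocal f0 fnil 0%R.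
have [N' N'P] := nilpotent_ball int_metric fnil w 0%R (D + R + r * N).
pose n := N + N'.
have [v vhit] : exists v, iter n f w v <> a0.
  apply: contrapT => /forallNP nov; apply: wimm; exists n.
  by apply/funext => v; apply: contrapT; apply: nov.
have vfar : D + R + r * N < dist 0%R v.
  rewrite ltnNge; apply/negP => vnear; apply: vhit.
  by apply: N'P => //; rewrite /n leq_addl.
(* [L] is so large that the cells within distance [r * n] of [v], and those
   within distance [D + r * N] of it, do not meet the outer walls. *)
pose L := dist 0%R v + R + R + r * n + D + r * N + 1.
have LE : L = dist 0%R v + R + R + r * n + D + r * N + 1 by [].
pose Y i := if dist 0%R i <= R then w i else
  if dist (Posz L) i <= R then w (i - Posz L)%R else
  if dist (- Posz L)%R i <= R then w (i + Posz L)%R else a0.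
have YR : agree dist R 0%R w (fun i => Y (i + Posz L)%R).
  move=> u uR; rewrite /int_dist in uR LE.
  rewrite /Y /int_dist ifF; last by lia.
  by rewrite ifT ?addrK //; lia.
have YL : agree dist R 0%R w (fun i => Y (i + - Posz L)%R).
  move=> u uR; rewrite /int_dist in uR LE.
  rewrite /Y /int_dist ifF; last by lia.
  by rewrite ifF ?ifT ?addrNK //; lia.
have Ymid i : dist 0%R i + R < L -> Y i = w i.
  move=> iL; rewrite /Y; case: (leqP (dist 0%R i) R) => // iR.
  rewrite (wR i) //; rewrite /int_dist in iL LE *.
  by rewrite !ifF //; lia.
have wallR m : N <= m -> agree dist r (Posz L) (iter m f Y) zero.
  move=> Nm u uL; have := wall _ YR m Nm (u - Posz L)%R; rewrite iter_shift subrK.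
  by apply; rewrite /int_dist in uL *; lia.
have wallL m : N <= m -> agree dist r (- Posz L)%R (iter m f Y) zero.
  move=> Nm u uL; have := wall _ YL m Nm (u + Posz L)%R; rewrite iter_shift addrK.
  by apply; rewrite /int_dist in uL *; lia.
pose q := truncate L (iter N f Y).
have qP : forall m, iter m f q = truncate L (iter (m + N) f Y).
  exact: iter_truncate_between_walls.
have qmortal : mortal a0 f q.
  apply: (mortal_bounded int_metric fnil (o := 0%R) (R := L)) => m u uL.
  by rewrite qP /truncate leqNgt uL.
pose q' i := q (i + v)%R.
have [T qT] := qmortal.
have := DP q' (L + dist 0%R v) _ _ _ N'; rewrite iter_shift add0r qP.
rewrite /truncate ifT; last by rewrite /L; lia.
rewrite [N' + N]addnC -/n => DP'; apply: vhit; rewrite -[RHS]DP'.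
- apply: (agree_at int_metric (n := 0)).
  apply: (iter_local int_metric flocal).
  move=> u vu; apply/esym/Ymid.
  by have := dist_triangle int_metric 0%R v u; rewrite /L; lia.
- move=> u uL; rewrite /q' /q /truncate ifF //; apply/negbTE.
  by rewrite /int_dist in uL *; lia.
- exists T; rewrite /q' iter_shift qT //.
move=> u uD; rewrite /q' /q /truncate; case: leqP => // uvL.
apply: (agree_at int_metric (n := 0)); apply: (iter_zero int_metric flocal f0).
move=> j uj; rewrite addn0 in uj; rewrite Ymid ?wR //.
  by rewrite /int_dist in vfar uD uj *; lia.
by rewrite /L /int_dist in vfar uD uj *; lia.
Qed.

End OneDimensional.

(** * Regular trees *)

Section RegularTree.
Context (k : nat) (V : choiceType) (e : rel V).
Hypothesis tree : regular_tree k e.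

Let e_sym := tree_sym tree.

Definition walk n x y := exists p, [/\ path e x p, last x p = y & size p = n].

Lemma walk_connected x y : exists n, `[< walk n x y >].
Proof.
have [p xp py] := tree_connected tree x y.
by exists (size p); apply/asboolP; exists p.
Qed.

Definition tree_dist x y := ex_minn (walk_connected x y).

Lemma tree_dist_walk x y : walk (tree_dist x y) x y.
Proof. by rewrite /tree_dist; case: ex_minnP => n /asboolP. Qed.

Lemma tree_dist_le n x y : walk n x y -> tree_dist x y <= n.
Proof. by rewrite /tree_dist; case: ex_minnP => m _ mle /asboolP/mle. Qed.

Lemma walk0 x : walk 0 x x.
Proof. by exists [::]. Qed.

Lemma walk_edge x y : e x y -> walk 1 x y.
Proof. by move=> xy; exists [:: y]; rewrite /= xy. Qed.

Lemma walk_cat n m x y z : walk n x y -> walk m y z -> walk (n + m) x z.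
Proof.
move=> [p [xp py <-]] [q [yq qz <-]]; exists (p ++ q).
by rewrite cat_path last_cat size_cat xp py.
Qed.

Lemma rev_walk x p : path e x p -> path e (last x p) (rev (belast x p)).
Proof. by rewrite rev_path; apply: sub_path => a b /=; rewrite e_sym. Qed.

Lemma last_rev_belast (T : Type) (x : T) p : last (last x p) (rev (belast x p)) = x.
Proof. by case: p => //= y p; rewrite rev_cons last_rcons. Qed.

Lemma walk_sym n x y : walk n x y -> walk n y x.
Proof.
move=> [p [xp <- <-]]; exists (rev (belast x p)).
by rewrite last_rev_belast size_rev size_belast; split=> //; apply: rev_walk.
Qed.

Lemma walk_last n x z : walk n.+1 x z -> exists2 y, walk n x y & e y z.
Proof.
move=> [p []]; elim/last_ind: p => // p y _.
rewrite rcons_path last_rcons size_rcons => /andP[xp py] <- [<-].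
by exists (last x p) => //; exists p.
Qed.

Lemma walk_eq0 x y : walk 0 x y -> x = y.
Proof. by move=> [[|z p] []]. Qed.

Lemma tree_metric : locally_finite_metric tree_dist.
Proof.
split=> [v|u v|u v w|v n].
- by apply/eqP; rewrite -leqn0; apply/tree_dist_le/walk0.
- apply/eqP; rewrite eqn_leq; apply/andP.
  by split; apply/tree_dist_le/walk_sym/tree_dist_walk.
- by apply/tree_dist_le/walk_cat; apply: tree_dist_walk.
elim: n => [|n [s sP]].
  exists [:: v] => u uv; have := tree_dist_walk v u.
  by rewrite (eqP (_ : tree_dist v u == 0)) -?leqn0 // => /walk_eq0<-; rewrite inE.
have /choice[nb nbP] : forall x, exists s : seq V, forall y, y \in s = e x y.
  by move=> x; have [t []] := tree_degree tree x; exists t.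
exists (s ++ flatten [seq nb x | x <- s]) => u; rewrite mem_cat leq_eqVlt ltnS.
case/orP => [/eqP du|/sP->//]; apply/orP; right.
have := tree_dist_walk v u; rewrite du => /walk_last[y vy yu].
apply/flattenP; exists (nb y); last by rewrite nbP.
by apply: map_f; apply/sP/tree_dist_le.
Qed.

(** Such a path would close up to a cycle through [x]. *)
Lemma no_detour x y y' p : e x y -> e x y' -> y != y' ->
  path e y p -> last y p = y' -> x \notin y :: p -> False.
Proof.
move=> xy xy' yy' yp lp xyp; move: xy' yy'; rewrite -lp.
case/shortenP: yp => q yq yq_uniq sub xy' yy'.
have := tree_acyclic tree (c := x :: y :: q).
have -> : size (x :: y :: q) <= 2 = (size q == 0) by case: (q).
move=> short; have /eqP/size0nil q0 : size q == 0.
  apply: short; rewrite /ucycle /=.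
  rewrite rcons_path xy yq e_sym xy' /=.
  move: yq_uniq => /= ->; rewrite andbT; apply: contra xyp.
  by rewrite !inE => /orP[->//|/sub->]; rewrite orbT.
by rewrite q0 /= eqxx in yy'.
Qed.

(** ** Rooted trees *)

Section Rooted.
Variable o : V.
Local Notation depth := (tree_dist o).

Lemma depth_root : depth o = 0.
Proof. exact: dist_refl tree_metric o. Qed.

Lemma depth_eq0 x : depth x = 0 -> x = o.
Proof. by move=> x0; have := tree_dist_walk o x; rewrite x0 => /walk_eq0. Qed.

Lemma depth_edge x y : e x y -> depth y <= (depth x).+1.
Proof.
move=> xy; rewrite -addn1; apply: tree_dist_le.
exact: walk_cat (tree_dist_walk _ _) (walk_edge xy).
Qed.

Lemma exists_parent x : x <> o -> exists2 y, e x y & depth x = (depth y).+1.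
Proof.
move=> xo; have := tree_dist_walk o x.
case dx: (depth x) => [|n]; first by case: xo; apply: depth_eq0.
move=> /walk_last[y oy yx]; exists y; first by rewrite e_sym.
have := depth_edge yx; have := tree_dist_le oy; lia.
Qed.

Lemma descending_path y :
  exists p, [/\ path e y p, last y p = o & forall z, z \in p -> depth z < depth y].
Proof.
have [n] := ubnP (depth y); elim: n y => // n IHn y yn.
have [->|/eqP yo] := eqVneq y o; first by exists [::].
have [z yz zd] := exists_parent yo.
have [|p [zp pl pd]] := IHn z; first by lia.
exists (z :: p); rewrite /= yz zp; split=> // t; rewrite inE => /orP[/eqP->|/pd]; lia.
Qed.

(** Two such neighbours would be joined by a path through the root that avoids
    [x]. *)
Lemma parent_unique x y y' : e x y -> e x y' ->
  depth y <= depth x -> depth y' <= depth x -> y = y'.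
Proof.
move=> xy xy' dy dy'; apply/eqP/negP => /negP yy'.
have [p [yp lp pd]] := descending_path y.
have [p' [yp' lp' pd']] := descending_path y'.
apply: (no_detour xy xy' yy' (p := p ++ rev (belast y' p'))).
- by rewrite cat_path yp lp -lp' rev_walk.
- by rewrite last_cat lp -lp' last_rev_belast.
have xNe z : e x z -> x != z.
  by apply: contraTneq => ->; rewrite (tree_irr tree).
rewrite inE mem_cat mem_rev !negb_or xNe //=; apply/andP; split.
  by apply/negP => /pd; lia.
apply/negP => /mem_belast; rewrite inE => /orP[|/pd']; last by lia.
by apply/negP/xNe.
Qed.

Lemma exists_parent_map : exists par : V -> V, par o = o /\
  forall x, x <> o -> e x (par x) /\ depth x = (depth (par x)).+1.
Proof.
have /choice[par parP] : forall x, exists y, (x = o -> y = o) /\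
    (x <> o -> e x y /\ depth x = (depth y).+1).
  move=> x; have [xo|xo] := pselect (x = o); first by exists o.
  by have [y xy yd] := exists_parent xo; exists y.
by exists par; split=> [|x xo]; [apply: (parP o).1|apply: (parP x).2].
Qed.

End Rooted.
End RegularTree.

Section Rays.
Context (k : nat) (V : choiceType) (e : rel V).
Hypothesis tree : regular_tree k e.
Variables (o : V) (par : V -> V).
Local Notation depth := (tree_dist tree o).
Hypothesis par_root : par o = o.
Hypothesis parP : forall x, x <> o -> e x (par x) /\ depth x = (depth (par x)).+1.

Lemma par_edge x y : e x y -> depth y <= depth x -> x <> o /\ par x = y.
Proof.
move=> xy dy; have xo : x <> o.
  move=> xo; rewrite xo depth_root leqn0 in dy.
  move: xy; rewrite xo (depth_eq0 (eqP dy)).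
  by rewrite (tree_irr tree).
have [xpar dpar] := parP xo.
by split=> //; apply: (parent_unique (tree := tree) (o := o) xpar xy) => //; lia.
Qed.

Lemma depth_iter_par i y : iter i par y <> o -> depth y = depth (iter i par y) + i.
Proof.
elim: i y => [|i IHi] y; rewrite ?addn0 // iterSr => yo.
have yNo : y <> o.
  by move=> y0; apply: yo; rewrite y0 par_root; elim: (i) => //= j ->.
by rewrite (parP yNo).2 (IHi _ yo) addnS.
Qed.

Lemma iter_par_depth i y : i <= depth y -> depth (iter i par y) = depth y - i.
Proof.
elim: i => [|i IHi] iy; rewrite ?subn0 //=.
have := IHi (ltnW iy); set z := iter i par y => dz.
have zo : z <> o by move=> zo; rewrite zo depth_root in dz; lia.
by have := (parP zo).2; lia.
Qed.

Hypothesis k_ge2 : 2 <= k.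

Lemma exists_child x : exists y, par y = x /\ y <> o.
Proof.
have [s [s_uniq ss sP]] := tree_degree tree x.
have [y ys /eqP yx] : exists2 y, y \in s & y != par x.
  apply/hasP; rewrite has_predC; apply/negP => /allP sx.
  have : size s <= size [:: par x].
    by apply: uniq_leq_size => // y /sx /= /eqP->; rewrite inE.
  by rewrite ss /=; lia.
have xy : e x y by rewrite -sP.
exists y; have [dyx|dxy] := leqP (depth y) (depth x).
  by have [_ /esym] := par_edge xy dyx.
by apply/and_comm/par_edge; [rewrite (tree_sym tree)|apply: ltnW].
Qed.

Lemma exists_two_children : exists y z,
  [/\ par y = o, par z = o, y <> o, z <> o & y <> z].
Proof.
have [[|y [|z s]] [s_uniq ss sP]] := tree_degree tree o; try by rewrite /= in ss; lia.
have child t : t \in [:: y, z & s] -> par t = o /\ t <> o.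
  rewrite sP => ot; apply/and_comm/par_edge; rewrite ?depth_root //.
  by rewrite (tree_sym tree).
have [|yo yNo] := child y; first by rewrite inE eqxx.
have [|zo zNo] := child z; first by rewrite !inE eqxx orbT.
by exists y, z; split=> // yz; move: s_uniq; rewrite yz /= inE eqxx.
Qed.

Lemma exists_ray y : par y = o -> y <> o ->
  exists a : nat -> V,
    [/\ a 0 = o, a 1 = y & forall i, par (a i.+1) = a i /\ a i.+1 <> o].
Proof.
move=> yo yNo; have /choice[child childP] := exists_child.
exists (fun i => if i is j.+1 then iter j child y else o); split=> // -[|i] //=.
Qed.

End Rays.

(** An end of the tree, seen as the map sending each vertex to the next one on
    the ray towards that end. *)
Record tree_end (V : choiceType) (e : rel V) (o : V) (p : V -> V) : Prop := TreeEnd {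
  end_edge : forall x y, e x y = (p x == y) || (p y == x);
  end_ray_inj : forall m n, iter m p o = iter n p o -> m = n;
  end_confluent : forall x, exists m n, iter m p x = iter n p o }.

Section RayEnd.
Context (k : nat) (V : choiceType) (e : rel V).
Hypothesis tree : regular_tree k e.
Variables (o : V) (par : V -> V) (a : nat -> V).
Local Notation depth := (tree_dist tree o).
Hypothesis par_root : par o = o.
Hypothesis parP : forall x, x <> o -> e x (par x) /\ depth x = (depth (par x)).+1.
Hypothesis a0 : a 0 = o.
Hypothesis aP : forall i, par (a i.+1) = a i /\ a i.+1 <> o.

Definition ray_end x := if x == a (depth x) then a (depth x).+1 else par x.

Lemma depth_ray i : depth (a i) = i.
Proof.
elim: i => [|i IHi]; first by rewrite a0 depth_root.
by have [pai /parP[_ ->]] := aP i; rewrite pai IHi.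
Qed.

Lemma ray_end_on i : ray_end (a i) = a i.+1.
Proof. by rewrite /ray_end depth_ray eqxx. Qed.

Lemma ray_end_off x : (forall i, x <> a i) -> ray_end x = par x.
Proof. by move=> xa; rewrite /ray_end; case: eqP => // /xa. Qed.

Lemma iter_ray_end i j : iter i ray_end (a j) = a (i + j).
Proof. by elim: i => // i IHi; rewrite iterS IHi ray_end_on addSn. Qed.

Lemma ray_end_is_end : tree_end e o ray_end.
Proof.
have one_way x y : e x y -> depth y <= depth x ->
      (ray_end x == y) || (ray_end y == x).
  move=> xy dy; have [xo parx] := par_edge parP xy dy.
  rewrite {1}/ray_end; case: (x =P a (depth x)) => [xa|_]; last by rewrite parx eqxx.
  case dx: (depth x) xa => [|i] xa; first by case: xo; rewrite xa a0.
  apply/orP; right; apply/eqP; rewrite -parx xa (aP i).1.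
  exact: ray_end_on.
have edge_up x : e x (ray_end x).
  rewrite /ray_end; case: (x =P a (depth x)) => [{1}->|xa].
    have [{1}<- /parP[ea _]] := aP (depth x).
    by rewrite (tree_sym tree).
  have xo : x <> o by move=> xo; apply: xa; rewrite xo depth_root a0.
  by have [] := parP xo.
split=> [x y|m n|x].
- apply/idP/idP => [xy|/orP[] /eqP<-//]; last by rewrite (tree_sym tree).
  have [dyx|dxy] := leqP (depth y) (depth x); first exact: one_way.
  by rewrite orbC; apply: one_way (ltnW dxy); rewrite (tree_sym tree).
- rewrite -a0 !iter_ray_end => /(congr1 depth).
  by rewrite !depth_ray !addn0.
have [n] := ubnP (depth x); elim: n x => // n IHn x xn.
have [/eqP xa|xa] := boolP (x == a (depth x)).
  exists 0, (depth x); have := iter_ray_end (depth x) 0.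
  by rewrite a0 addn0 -xa => ->.
have xo : x <> o.
  by move=> xo; move: xa; rewrite xo depth_root a0 eqxx.
have [_ dx] := parP xo.
have [|m [m' E]] := IHn (par x); first by lia.
by exists m.+1, m'; rewrite iterSr /ray_end (negbTE xa).
Qed.

Lemma iter_ray_end_off u i y :
  (forall j, u <> a j) -> iter i ray_end y = u <-> iter i par y = u.
Proof.
move=> ua; elim: i y => // i IHi y; rewrite !iterSr.
have [[j ->]|ya] := pselect (exists j, y = a j); last first.
  by rewrite ray_end_off // => j yj; apply: ya; exists j.
split=> [|E]; first by rewrite ray_end_on iter_ray_end => /esym/ua.
suff [j' /ua//] : exists j', u = a j'.
rewrite -E -iterSr; elim: (i.+1) => [|n [j' IHn]]; first by exists j.
rewrite iterS IHn; case: (j') => [|j'']; first by exists 0; rewrite a0.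
by exists j''; have [] := aP j''.
Qed.

End RayEnd.

Section TwoEnds.
Context (k : nat) (V : choiceType) (e : rel V).
Hypothesis k_ge2 : 2 <= k.
Hypothesis tree : regular_tree k e.

(** Every vertex [u <> o] is off one of two rays leaving [o] in different
    directions, so the vertices that [u] separates from [o] are the descendants
    of [u] with respect to one of two ends. *)
Lemma two_ends o : exists p1 p2 : V -> V, [/\ tree_end e o p1, tree_end e o p2 &
  forall v R, 0 < R <= tree_dist tree o v ->
    exists p u, [/\ p = p1 \/ p = p2, iter (tree_dist tree o v - R) p v = u &
      forall i y, iter i p y = u -> tree_dist tree o y = R + i]].
Proof.
have [par [par_root parP]] := exists_parent_map tree o.
have [y [z [yo zo yNo zNo yz]]] := exists_two_children parP k_ge2.
have [a [a0 a1 aP]] := exists_ray parP k_ge2 yo yNo.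
have [b [b0 b1 bP]] := exists_ray parP k_ge2 zo zNo.
exists (ray_end tree o par a), (ray_end tree o par b); split.
- exact: ray_end_is_end.
- exact: ray_end_is_end.
move=> v R /andP[R_gt0 Rv]; set u := iter (tree_dist tree o v - R) par v.
have du : tree_dist tree o u = R.
  by rewrite (iter_par_depth parP) ?subKn // leq_subr.
have uo : u <> o by move=> uo; rewrite uo depth_root in du; lia.
have desc c : c 0 = o -> (forall i, par (c i.+1) = c i /\ c i.+1 <> o) ->
    (forall j, u <> c j) ->
    iter (tree_dist tree o v - R) (ray_end tree o par c) v = u /\
    forall i y, iter i (ray_end tree o par c) y = u -> tree_dist tree o y = R + i.
  move=> c0 cP uc.
  have offE i t : iter i (ray_end tree o par c) t = u <-> iter i par t = u.
    exact: iter_ray_end_off.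
  split=> [|i t /offE iu]; first exact/offE.
  by rewrite -du -iu; apply: depth_iter_par => //; rewrite iu.
have [[i ua]|ua] := pselect (exists i, u = a i); last first.
  have [|??] := desc a a0 aP; first by move=> j uj; apply: ua; exists j.
  by exists (ray_end tree o par a), u; split=> //; left.
have [[j ub]|ub] := pselect (exists j, u = b j); last first.
  have [|??] := desc b b0 bP; first by move=> j uj; apply: ub; exists j.
  by exists (ray_end tree o par b), u; split=> //; right.
exfalso; have ji : j = i.
  by rewrite -(depth_ray parP b0 bP j) -ub ua (depth_ray parP a0 aP).
case: i ua ji => [|i] ua ji; first by apply: uo; rewrite ua a0.
have abE : a i.+1 = b i.+1 by rewrite -ua ub ji.
elim: (i) abE => [|n IHn]; first by rewrite a1 b1.
by move=> E; apply: IHn; rewrite -(aP n.+1).1 E (bP n.+1).1.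
Qed.

End TwoEnds.

(** * Automorphisms fixing an end *)

Section EndAutomorphisms.
Context (k : nat) (V : choiceType) (e : rel V).
Hypothesis tree : regular_tree k e.
Variables (o : V) (p : V -> V).
Hypothesis pend : tree_end e o p.

Lemma exists_level : exists lev : V -> int, forall x m n,
  iter m p x = iter n p o -> (lev x + Posz m = Posz n)%R.
Proof.
have /choice[lev levP] : forall x, exists l : int, forall m n,
    iter m p x = iter n p o -> (l + Posz m = Posz n)%R.
  move=> x; have [m [n mn]] := end_confluent pend x.
  exists (Posz n - Posz m)%R => m' n' mn'.
  have : iter (m' + n) p o = iter (m + n') p o.
    by rewrite !iterD -mn -mn' -!iterD addnC.
  by move/(end_ray_inj pend); lia.
by exists lev.
Qed.

(** The Busemann function of the end, increasing towards it, with value [0] at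
    [o]. *)
Definition level : V -> int := projT1 (cid exists_level).

Lemma level_root m n x : iter m p x = iter n p o -> (level x + Posz m = Posz n)%R.
Proof. by rewrite /level; case: cid => l /= lP; apply: lP. Qed.

Lemma level_up x : level (p x) = (level x + 1)%R.
Proof.
have [m [n mn]] := end_confluent pend x.
have := level_root mn.
have : iter m p (p x) = iter n.+1 p o by rewrite -iterSr !iterS mn.
by move/level_root; lia.
Qed.

Lemma level_iter n x : level (iter n p x) = (level x + Posz n)%R.
Proof. by elim: n => [|n IHn] /=; rewrite ?addr0 // level_up IHn; lia. Qed.

Lemma confluent x y : exists m n, iter m p x = iter n p y.
Proof.
have [m [n mn]] := end_confluent pend x.
have [m' [n' mn']] := end_confluent pend y.
exists (n' + m), (n + m').
by rewrite !iterD mn mn' -!iterD addnC.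
Qed.

Lemma edge_level x y :
  e x y -> (level y <= level x + 1)%R /\ (level x <= level y + 1)%R.
Proof. by rewrite (end_edge pend) => /orP[] /eqP<-; rewrite level_up; lia. Qed.

(** A labeling enumerates the children of every vertex, so that a vertex below
    another one is described by a word of labels. *)
Definition labeling (cl : V -> seq V) :=
  forall t, [/\ uniq (cl t), size (cl t) = k.-1
    & forall y, (y \in cl t) = (p y == t)].

Lemma labeling_exists : exists cl, labeling cl.
Proof.
suff /choice[cl clP] : forall t, exists s, [/\ uniq s, size s = k.-1
    & forall y, (y \in s) = (p y == t)] by exists cl.
move=> t; have [s [s_uniq ss sP]] := tree_degree tree t.
exists (rem (p t) s).
have pts : p t \in s by rewrite sP (end_edge pend) eqxx.
split=> [||y]; first exact: rem_uniq.
  by rewrite size_rem // ss.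
rewrite mem_rem_uniq // inE sP (end_edge pend).
have [pyt|] := eqVneq (p y) t; last by rewrite orbF [y == _]eq_sym andNb.
rewrite orbT andbT; apply/eqP => ypt.
by have := level_up y; have := level_up t; rewrite pyt -ypt; lia.
Qed.

(** A normalization under which a map matching labels and sending [u] to [v] also
    sends the ray from [u] to the end to the ray from [v]. *)
Definition leads cl v := forall n, index (iter n p v) (cl (iter n.+1 p v)) = 0.

Lemma leading_labeling v : exists cl, labeling cl /\ leads cl v.
Proof.
have [cl clP] := labeling_exists.
suff /choice[cl' cl'P] : forall t, exists s, [/\ uniq s, size s = k.-1,
    forall y, (y \in s) = (p y == t)
    & forall n, iter n.+1 p v = t -> index (iter n p v) s = 0].
  exists cl'; split=> [t|n]; first by have [] := cl'P t.
  by have [_ _ _] := cl'P (iter n.+1 p v); apply.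
move=> t; have [t_uniq ts tP] := clP t.
have [[n nt]|tray] := pselect (exists n, iter n.+1 p v = t); last first.
  by exists (cl t); split=> // n nt; case: tray; exists n.
have yt : iter n p v \in cl t by rewrite tP -nt.
exists (iter n p v :: rem (iter n p v) (cl t)); split=> [||y|m mt].
- by rewrite /= mem_rem_uniqF // rem_uniq.
- by rewrite /= size_rem // ts prednK // -ts; case: (cl t) yt.
- by rewrite inE mem_rem_uniq // inE -tP; case: eqVneq => [->|].
have -> : m = n.
  have := congr1 level (etrans mt (esym nt)).
  by rewrite !level_iter; lia.
by rewrite /= eqxx.
Qed.

Lemma mem_label cl x : labeling cl -> x \in cl (p x).
Proof. by move=> clP; have [_ _ ->] := clP (p x). Qed.

(** A vertex is determined by its label and the vertex above it. *)
Lemma rigid cl h u : labeling cl ->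
  (forall x, p (h x) = h (p x)) -> h u = u ->
  (forall x, index (h x) (cl (p (h x))) = index x (cl (p x))) -> h =1 id.
Proof.
move=> clP hp hu hl x /=; have [m [n mn]] := confluent x u.
elim: m x mn => [|m IHm] x mn.
  by rewrite [x]mn; elim: (n) => //= i IHi; rewrite -hp IHi.
have hpx : h (p x) = p x by apply: IHm; rewrite -iterSr.
have hx_mem : h x \in cl (p x) by rewrite -hpx -hp mem_label.
by apply: (index_inj x hx_mem (mem_label x clP)); have := hl x; rewrite hp hpx.
Qed.

(** Climb from [x] to a vertex [iter n p u] above [u], go over to [iter n p v] and
    descend along the same labels. The result does not depend on [n], because the
    rays from [u] and [v] both carry the label [0]. *)
Lemma label_map cl cl' u v :
  labeling cl -> labeling cl' -> leads cl u -> leads cl' v ->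
  exists g : V -> V, [/\ forall x, p (g x) = g (p x), g u = v
    & forall x, index (g x) (cl' (p (g x))) = index x (cl (p x))].
Proof.
move=> clP cl'P ulead vlead.
pose G := fix G m n x := if m is m'.+1 then
  nth x (cl' (G m' n (p x))) (index x (cl (p x))) else iter n p v.
have index_small x t : index x (cl (p x)) < size (cl' t).
  have [_ -> _] := cl'P t; have [_ <- _] := clP (p x).
  by rewrite index_mem mem_label.
have G_up m n x : p (G m.+1 n x) = G m n (p x).
  rewrite /=; have [_ _ mem] := cl'P (G m n (p x)).
  by apply/eqP; rewrite -mem mem_nth.
have G_diag m n x : iter m p x = iter n p u -> G m.+1 n.+1 x = G m n x.
  elim: m x => [|m IHm] x mn.
    rewrite /= in mn; rewrite mn /=.
    have := ulead n; rewrite iterS => ->.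
    have := vlead n; rewrite iterS => {1}<-.
    by rewrite nth_index // mem_label.
  by rewrite /= -/G; congr (nth x (cl' _) _); apply: IHm; rewrite -iterSr.
have G_shift i m n x : iter m p x = iter n p u -> G (i + m) (i + n) x = G m n x.
  move=> mn; elim: i => // i IHi; rewrite !addSn G_diag //.
  by rewrite !iterD mn.
have /choice[g gP] : forall x, exists y, forall m n,
    iter m p x = iter n p u -> y = G m n x.
  move=> x; have [m [n mn]] := confluent x u; exists (G m n x) => m' n' mn'.
  rewrite -(G_shift m' _ _ _ mn) -(G_shift m _ _ _ mn') (addnC m').
  congr (G _ _ x); have := congr1 level mn; have := congr1 level mn'.
  by rewrite !level_iter; lia.
have g_up x : p (g x) = g (p x) /\ index (g x) (cl' (p (g x))) = index x (cl (p x)).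
  have [m [n mn]] := confluent x u.
  have mn1 : iter m.+1 p x = iter n.+1 p u by rewrite !iterS mn.
  have mn1' : iter m p (p x) = iter n.+1 p u by rewrite -iterSr.
  rewrite (gP _ _ _ mn1) (gP _ _ _ mn1') G_up; split=> //.
  by rewrite /= -/G index_uniq //; have [] := cl'P (G m n.+1 (p x)).
exists g; split=> [x||x]; [exact: (g_up x).1| |exact: (g_up x).2].
by rewrite (gP u 0 0).
Qed.

Lemma end_automorphism cl cl' u v :
  labeling cl -> labeling cl' -> leads cl u -> leads cl' v ->
  exists g : graph_aut e, [/\ forall x, p (g x) = g (p x), g u = v
    & forall x, index (g x) (cl' (p (g x))) = index x (cl (p x))].
Proof.
move=> clP cl'P ulead vlead.
have [g [gp gu gl]] := label_map clP cl'P ulead vlead.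
have [h [hp hv hl]] := label_map cl'P clP vlead ulead.
have gK : cancel g h.
  apply: (rigid (cl := cl) (u := u)) => // [x|| x] /=.
  - by rewrite hp gp.
  - by rewrite gu.
  - by rewrite hl gl.
have hK : cancel h g.
  apply: (rigid (cl := cl') (u := v)) => // [x|| x] /=.
  - by rewrite gp hp.
  - by rewrite hv.
  - by rewrite gl hl.
have ge x y : e (g x) (g y) = e x y.
  by rewrite !(end_edge pend) !gp !(can_eq gK).
by exists (GraphAut gK hK ge).
Qed.

Lemma level_transitive u v : exists2 g : graph_aut e, g u = v
  & forall x, (level (g x) - level v = level x - level u)%R.
Proof.
have [cl [clP ulead]] := leading_labeling u.
have [cl' [cl'P vlead]] := leading_labeling v.
have [g [gp gu _]] := end_automorphism clP cl'P ulead vlead.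
have gi n x : iter n p (g x) = g (iter n p x).
  by elim: n => //= n ->; rewrite gp.
exists g => // x; have [m [n mn]] := confluent x u.
have gmn : iter m p (g x) = iter n p v by rewrite gi mn -gi gu.
by have := congr1 level mn; have := congr1 level gmn; rewrite !level_iter; lia.
Qed.

(** Use a labeling leading from [v] and one leading from [v'] that coincide except
    below [u]. *)
Lemma descendants_transitive u v v' m : iter m p v = u -> iter m p v' = u ->
  exists2 g : graph_aut e, g v = v'
    & forall x, (forall i, iter i p x <> u) -> g x = x.
Proof.
move=> vu v'u.
have [cl [clP vlead]] := leading_labeling v.
have [cl1 [cl1P v'lead]] := leading_labeling v'.
pose cl' t := if `[< exists i, iter i p t = u >] then cl1 t else cl t.
have cl'P : labeling cl'.
  by move=> t; rewrite /cl'; case: asboolP => _; [apply: cl1P|apply: clP].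
have v'lead' : leads cl' v'.
  move=> n; rewrite /cl'; case: asboolP => // noti.
  have mn : m <= n.
    rewrite leqNgt; apply/negP => nm; apply: noti; exists (m - n.+1).
    by rewrite -iterD subnK.
  have same j : m <= j -> iter j p v' = iter j p v.
    by move=> mj; rewrite -(subnK mj) !iterD vu v'u.
  by rewrite !same //; apply: leqW.
have [g [gp gv gl]] := end_automorphism clP cl'P vlead v'lead'.
have gi n x : iter n p (g x) = g (iter n p x).
  by elim: n => //= n ->; rewrite gp.
exists g => // x; have [j [n jn]] := confluent x v.
elim: j x jn => [|j IHj] x jn xu.
  rewrite /= in jn; rewrite jn -gi gv.
  have [nm|mn] := leqP n m.
    by case: (xu (m - n)); rewrite jn -iterD subnK.
  by rewrite -(subnK (ltnW mn)) !iterD vu v'u.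
have pxu i : iter i p (p x) <> u by rewrite -iterSr; apply: xu.
have gpx : g (p x) = p x by apply: IHj => //; rewrite -iterSr.
have := gl x; rewrite gp gpx /cl'; case: asboolP => [[i /pxu]//|_].
have gx_mem : g x \in cl (p x) by rewrite -gpx -gp mem_label.
exact: (index_inj x gx_mem (mem_label x clP)).
Qed.

End EndAutomorphisms.

(** * Invariant local maps on a regular tree *)

Section TreeMaps.
Context (k : nat) (V : choiceType) (e : rel V).
Hypothesis k_ge2 : 2 <= k.
Hypothesis tree : regular_tree k e.
Context (A : finType) (a0 : A) (r : nat) (f : (V -> A) -> V -> A).
Local Notation dist := (tree_dist tree).
Local Notation zero := (fun=> a0).
Hypothesis flocal : local dist r f.
Hypothesis finv : forall (g : graph_aut e) x, f (x \o g) = f x \o g.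
Hypothesis f0 : f zero = zero.
Hypothesis fnil : pointwise_nilpotent a0 f.

Lemma iter_inv n (g : graph_aut e) x : iter n f (x \o g) = iter n f x \o g.
Proof. by elim: n => //= n ->; rewrite finv. Qed.

Section Horocyclic.
Variables (o : V) (p : V -> V).
Hypothesis pend : tree_end e o p.
Local Notation lev := (level pend).

Lemma level_surjective : exists s : int -> V, forall j, lev (s j) = j.
Proof.
have up (n : nat) : lev (iter n p o) = Posz n.
  by rewrite level_iter; have := level_root pend (erefl (iter 0 p o)); lia.
have down (n : nat) : exists v, lev v = (- Posz n)%R.
  elim: n => [|n [v vn]]; first by exists (iter 0 p o); rewrite up.
  have [cl /(_ v)[_ clv mem]] := labeling_exists tree pend.
  have [y] : exists y, y \in cl v.
    case: (cl v) clv => [|y s] /=; first by lia.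
    by move=> _; exists y; rewrite inE eqxx.
  by rewrite mem => /eqP yv; exists y; have := level_up pend y; rewrite yv; lia.
suff /choice[s sP] : forall j, exists v, lev v = j by exists s.
case=> n; first by exists (iter n p o).
by have [v vn] := down n.+1; exists v; rewrite vn NegzE.
Qed.

Lemma walk_level n u v : walk e n u v -> int_dist (lev u) (lev v) <= n.
Proof.
elim: n v => [|n IHn] v; first by move=> /walk_eq0->; rewrite (dist_refl int_metric).
move=> /walk_last[w /IHn uw /(edge_level pend)].
by rewrite /int_dist in uw *; lia.
Qed.

(** Along the levels of an end the map acts as a one-dimensional cellular
    automaton, because the automorphisms fixing the end act transitively on each
    level and realise all translations of the levels. *)
Lemma horocyclic_nilpotent : exists N, forall (y : int -> A) n, N <= n ->
  iter n f (y \o lev) = zero.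
Proof.
have [s sP] := level_surjective.
pose phi (y : int -> A) j := f (y \o lev) (s j).
have f_lev y : f (y \o lev) = phi y \o lev.
  apply/funext => v; rewrite /= /phi.
  have [g gs glev] := level_transitive tree pend (s (lev v)) v.
  rewrite -{1}gs -[LHS]/((f (y \o lev) \o g) (s (lev v))) -finv; congr (f _ _).
  by apply/funext => x /=; congr y; have := glev x; rewrite sP; lia.
have iter_lev n y : iter n f (y \o lev) = iter n phi y \o lev.
  by elim: n => //= n ->; rewrite f_lev.
have [|||j|N NP] := @one_dimensional_nilpotent A a0 r phi.
- move=> i y y' yy'; apply: flocal => u iu; apply: yy'.
  by rewrite -{1}(sP i); apply: leq_trans iu; apply/walk_level/tree_dist_walk.
- move=> c y; apply/funext => i; rewrite /phi.
  have [g gs glev] := level_transitive tree pend (s i) (s (i + c)%R).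
  rewrite -gs -[RHS]/((f (y \o lev) \o g) (s i)) -finv; congr (f _ _).
  by apply/funext => x /=; congr y; have := glev x; rewrite !sP; lia.
- by apply/funext => j; rewrite /phi -[RHS](congr1 (@^~ (s j)) f0).
- move=> i; have [N NP] := fnil (j \o lev) (s i).
  by exists N => n /NP; rewrite iter_lev /= sP.
by exists N => y n Nn; rewrite iter_lev NP.
Qed.

Lemma near_descendant u v w n D : walk e n v w -> n <= D -> iter D p v = u ->
  exists i, iter i p w = u.
Proof.
move=> vw nD vu; suff [i] : exists i, D <= i + n /\ iter i p w = u by case; exists i.
elim: n w vw nD => [|n IHn] w; first by move=> /walk_eq0<-; exists D; rewrite addn0.
move=> /walk_last[t vt tw] nD.
have [[|i] [Di iu]] := IHn t vt (ltnW nD); first by lia.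
move: tw; rewrite (end_edge pend) => /orP[/eqP|/eqP] tw.
  by exists i; rewrite -tw -iterSr; split=> //; lia.
by exists i.+2; rewrite iterSr tw; split=> //; lia.
Qed.

(** If everything below [u] is quiescent at the start, the iterates stay constant on
    the levels below [u], so far enough from [u] they cannot be told apart from
    a configuration constant on all levels of the end. *)
Lemma descendants_die x u N :
  (forall y n, N <= n -> iter n f (y \o lev) = zero) ->
  (forall i v, iter i p v = u -> x v = a0) ->
  forall n v D, iter D p v = u -> r * N <= D -> iter (N + n) f x v = a0.
Proof.
move=> NP xu n v D vu ND.
have same m v1 v2 : iter m p v1 = u -> iter m p v2 = u ->
    iter n f x v1 = iter n f x v2.
  move=> v1u v2u; have [g <- gfix] := descendants_transitive tree pend v1u v2u.
  suff xg : x \o g = x by rewrite -[RHS]/((iter n f x \o g) v1) -iter_inv xg.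
  apply/funext => w /=.
  have [[i wu]|wu] := pselect (exists i, iter i p w = u); last first.
    by rewrite gfix // => i iw; apply: wu; exists i.
  rewrite (xu i w) //.
  have [[j gwu]|gwu] := pselect (exists j, iter j p (g w) = u); first exact: (xu j).
  have gw : g w = w.
    rewrite -[LHS](aut_funK g) -[RHS](aut_funK g); congr (aut_inv g _).
    by apply: gfix => j gj; apply: gwu; exists j.
  by case: gwu; exists i; rewrite gw.
have /choice[y yP] : forall j, exists b, forall i w,
    iter i p w = u -> lev w = j -> iter n f x w = b.
  move=> j; have [[w [i [wu wj]]]|now] :=
    pselect (exists w i, iter i p w = u /\ lev w = j); last first.
    by exists a0 => i w wu wj; case: now; exists w, i.
  exists (iter n f x w) => i' w' w'u w'j; apply: (same i') => //.
  suff <- : i = i' by [].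
  have := level_iter pend i w; have := level_iter pend i' w'.
  by rewrite wu w'u wj w'j; lia.
rewrite iterD -[RHS](congr1 (@^~ v) (NP y N (leqnn N))).
apply: (agree_at (tree_metric tree) (n := 0)).
apply: (iter_local (tree_metric tree) flocal) => w vw.
have [i wu] : exists i, iter i p w = u.
  by apply: near_descendant (tree_dist_walk tree v w) _ vu; lia.
exact: yP wu erefl.
Qed.

End Horocyclic.

(** Each vertex farther than [R] from [o] lies below a vertex at distance [R + 1]
    for one of two ends; this bounds the orbit at all times from [N] on, where [N]
    serves both ends. *)
Lemma finite_mortal o x R : (forall u, R < dist o u -> x u = a0) -> mortal a0 f x.
Proof.
move=> xR; have [p1 [p2 [end1 end2 pP]]] := two_ends k_ge2 tree o.
have [N1 N1P] := horocyclic_nilpotent end1.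
have [N2 N2P] := horocyclic_nilpotent end2.
pose N := maxn N1 N2; pose D := R.+1 + r * N.
have far n v : D < dist o v -> iter (N + n) f x v = a0.
  move=> Dv; have [|p [u [pE vu depth_u]]] := pP v R.+1; first by lia.
  have xu i w : iter i p w = u -> x w = a0.
    by move=> /depth_u wd; apply: xR; lia.
  have rD : r * N <= dist o v - R.+1 by lia.
  case: pE => pE; subst p.
    apply: (descendants_die (pend := end1) _ xu n vu rD) => y m Nm.
    by apply: N1P; lia.
  apply: (descendants_die (pend := end2) _ xu n vu rD) => y m Nm.
  by apply: N2P; lia.
have [T NT] : mortal a0 f (iter N f x).
  apply: (mortal_bounded (tree_metric tree) fnil (o := o) (R := D)) => n v Dv.
  by rewrite -iterD addnC; apply: far.
by exists (T + N); rewrite iterD.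
Qed.

(** What can hit [o] at a given time is a finite part of the configuration, which
    is mortal, so the ball of [mortal_zero_ball] protects [o] from everything. *)
Lemma tree_map_nilpotent : exists N, forall x n, N <= n -> iter n f x = zero.
Proof.
have [o] := tree_inhabited tree.
have metric := tree_metric tree.
have [D DP] := mortal_zero_ball metric flocal f0 fnil o.
have [x xD n|N NP] := zero_ball_wall_uniform metric flocal fnil (o := o) (D := D).
  pose q u := if dist o u <= r * n then x u else a0.
  have qfin u : r * n < dist o u -> q u = a0 by rewrite /q ltnNge => /negbTE->.
  rewrite -[RHS](DP q (r * n) qfin (finite_mortal qfin) _ n).
    apply: (agree_at metric (n := 0)); apply: (iter_local metric flocal) => u ou.
    by rewrite /q ifT //; lia.
  by move=> u ou; rewrite /q; case: ifP => // _; apply: xD.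
exists N => x n Nn; apply/funext => v.
have [p [_ [pend _ _]]] := two_ends k_ge2 tree o.
have [g gv _] := level_transitive tree pend o v.
by rewrite -gv -[LHS]/((iter n f x \o g) o) -iter_inv NP.
Qed.

End TreeMaps.

(** * Cellular automata *)

Section Configurations.
Context (V : choiceType) (A : finType).
Local Open Scope classical_set_scope.

Lemma config_cvgP (X : nat -> config V A) (x : config V A) :
  X n @[n --> \oo] --> x <->
  forall v, exists N, forall n, (N <= n)%N -> X n v = x v.
Proof.
have coord v :
    (fun y : config V A => y v) @ (X n @[n --> \oo]) -->
      (x v : discrete_topology A) <->
    exists N, forall n, (N <= n)%N -> X n v = x v.
  rewrite discrete_cvg; split=> [[N _ NP]|[N NP]]; exists N => // n /NP.
have cvgP := @pointwise_cvgP (discrete_topology V) (discrete_topology A).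
split=> [Xx v|Xx]; first by apply/coord; move: v; apply/cvgP.
by apply/cvgP => v; apply/coord.
Qed.

(** A point where no radius works is the limit of configurations whose images
    differ from its own at [v], so radii exist locally, hence by compactness
    globally. *)
Lemma continuous_local (dist : V -> V -> nat) (f : config V A -> config V A) v :
  locally_finite_metric dist -> continuous f ->
  exists r, forall x y, agree dist r v x y -> f x v = f y v.
Proof.
move=> metric fcont.
have [[a0 _]|noA] := pselect (exists a : A, True); last first.
  by exists 0 => x *; case: noA; exists (x v).
have [||r rP] := config_compact metric a0 (o := v)
    (Q := fun x n => forall y, agree dist n v x y -> f x v = f y v).
- by move=> x N M NM xN y xy; apply: xN; apply: agree_le xy.
- move=> x; apply: contrapT => /forallNP nox.
  have /choice[X XP] : forall R, exists y, agree dist R v x y /\ f x v <> f y v.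
    move=> R; apply: contrapT => noy; apply: (nox R); exists R => x' xx' y x'y.
    have fx y' : agree dist R v x y' -> f x v = f y' v.
      by move=> xy'; apply: contrapT => ne; apply: noy; exists y'.
    by rewrite -fx // -fx //; apply: agree_trans x'y.
  have Xx : X n @[n --> \oo] --> (x : config V A).
    apply/config_cvgP => u; exists (dist v u) => n vun.
    by apply/esym; apply: (XP n).1.
  have : f (X n) @[n --> \oo] --> f x.
    exact: (cvg_comp _ _ Xx (fcont x)).
  move/config_cvgP => /(_ v)[N /(_ N (leqnn N))] fX.
  by apply: (XP N).2.
by exists r.
Qed.

End Configurations.

Lemma walk_aut (V : choiceType) (e : rel V) (g : graph_aut e) n x y :
  walk e n x y -> walk e n (g x) (g y).
Proof.
move=> [p [xp <- <-]]; exists (map g p).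
rewrite path_map last_map size_map; split=> //.
by apply: sub_path xp => a b /=; rewrite aut_edge.
Qed.

Theorem theorem2 (k : nat) (k_ge2 : 2 <= k) (V : choiceType) (e : rel V)
    (Tk : regular_tree k e) :
  nilrigid (aut_action e).
Proof.
move=> A f [fcont fact] z fnil; split=> // U Uz.
have [o] := tree_inhabited Tk.
have metric := tree_metric Tk.
have fz x v : exists N, forall n, N <= n -> iter n f x v = z v.
  by have /config_cvgP := fnil x; apply.
have finv (g : graph_aut e) (x : config V A) : f (x \o g) = f x \o g.
  have := fact (aut_inverse g) x; rewrite /config_act.
  have -> : ((aut_inverse g)^-1)%g = g by apply: graph_aut_eq.
  by [].
have trans u v : exists g : graph_aut e, g u = v.
  have [p [_ [pend _ _]]] := two_ends k_ge2 Tk o.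
  by have [g gu _] := level_transitive Tk pend u v; exists g.
(* The iterates of a constant configuration are invariant under all
   automorphisms, and [z] is the limit of one such orbit. *)
have zE v : z v = z o.
  have [g <-] := trans o v.
  have [N NP] := fz (fun=> z o) (g o); have [N' N'P] := fz (fun=> z o) o.
  have const n : iter n f (fun=> z o) \o g = iter n f (fun=> z o).
    elim: n => //= n IHn; by rewrite -finv IHn.
  have zg := NP _ (leq_maxl N N'); have zo := N'P _ (leq_maxr N N').
  exact: etrans (esym zg) (etrans (congr1 (@^~ o) (const _)) zo).
have zconst : z = fun=> z o by apply/funext.
have [r rP] := continuous_local o metric fcont.
have flocal : local (tree_dist Tk) r f.
  move=> v x y xy; have [g gv] := trans o v.
  rewrite -gv -[LHS]/((f x \o g) o) -[RHS]/((f y \o g) o) -!finv.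
  apply: rP => u ou; apply: xy; rewrite -gv; apply: leq_trans ou.
  by apply/tree_dist_le/walk_aut/tree_dist_walk.
have nil : pointwise_nilpotent (z o) f.
  by move=> x v; have [N NP] := fz x v; exists N => n /NP->.
(* An orbit agrees with its limit around [v] from some time on. *)
have f0 : f (fun=> z o) = fun=> z o.
  apply/funext => v.
  have [N NP] := nilpotent_ball metric nil (fun=> z o) v r.
  have [N' N'P] := nil (fun=> z o) v.
  rewrite -[RHS](N'P (maxn N N').+1) /=; last by rewrite leqW ?leq_maxr.
  apply: flocal; apply: agree_sym.
  by apply: NP; rewrite leq_maxl.
have [N NP] := tree_map_nilpotent k_ge2 flocal finv f0 nil.
exists N => n x /NP->.
by rewrite -zconst; apply: nbhs_singleton.
Qed.
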